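(* Let $Q$ be a compact subset of $\mathbb{R}^{d}$, let $\mathbf{a}_1,\mathbf{a}_2\in\mathbb{R}^d\setminus\{\mathbf{0}\}$ be fixed vectors, and let $\mathcal{R}=\mathcal{R}(\mathbf{a}_1,\mathbf{a}_2)=\{g_1(\mathbf{a}_1\cdot\mathbf{x})+g_2(\mathbf{a}_2\cdot\mathbf{x}) : g_1,g_2\in C(\mathbb{R})\}$, regarded as a linear subspace of $C(Q)$ by restriction to $Q$. Let $f\in C(Q)$. A function $G_0\in\mathcal{R}$ is a best approximation to $f$, that is, $\|f-G_0\|=\inf_{G\in\mathcal{R}}\|f-G\|$, if and only if there exists a closed path or an infinite path $p=(\mathbf{p}_1,\mathbf{p}_2,\ldots)$ in $Q$ (with respect to the directions $\mathbf{a}_1$ and $\mathbf{a}_2$) which is extremal for the function $f-G_0$.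
   Context: $C(Q)$ is the space of continuous real-valued functions on $Q$ with the uniform norm $\|h\|=\max_{\mathbf{x}\in Q}|h(\mathbf{x})|$, $C(\mathbb{R})$ is the space of continuous real-valued functions on $\mathbb{R}$, and $\mathbf{a}\cdot\mathbf{x}$ is the standard inner product on $\mathbb{R}^d$. Path: a finite or infinite ordered set (sequence) $(\mathbf{p}_1,\mathbf{p}_2,\ldots)$ of points of $Q$ with $\mathbf{p}_i\ne\mathbf{p}_{i+1}$ for all $i$, such that either $\mathbf{a}_1\cdot\mathbf{p}_1=\mathbf{a}_1\cdot\mathbf{p}_2$, $\mathbf{a}_2\cdot\mathbf{p}_2=\mathbf{a}_2\cdot\mathbf{p}_3$, $\mathbf{a}_1\cdot\mathbf{p}_3=\mathbf{a}_1\cdot\mathbf{p}_4,\ldots$ (alternating between $\mathbf{a}_1$ and $\mathbf{a}_2$), or $\mathbf{a}_2\cdot\mathbf{p}_1=\mathbf{a}_2\cdot\mathbf{p}_2$, $\mathbf{a}_1\cdot\mathbf{p}_2=\mathbf{a}_1\cdot\mathbf{p}_3$, $\mathbf{a}_2\cdot\mathbf{p}_3=\mathbf{a}_2\cdot\mathbf{p}_4,\ldots$ (alternating, starting with $\mathbf{a}_2$), is called a path with respect to the directions $\mathbf{a}_1$ and $\mathbf{a}_2$. An infinite path is one indexed by all positive integers. Closed path: if $(\mathbf{p}_1,\ldots,\mathbf{p}_n,\mathbf{p}_{n+1})$ is a finite path with $\mathbf{p}_{n+1}=\mathbf{p}_1$ and $n$ is an even (positive) number, then the path $(\mathbf{p}_1,\ldots,\mathbf{p}_n)$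 is called closed. Extremal path: a finite or infinite path $(\mathbf{p}_1,\mathbf{p}_2,\ldots)$ is extremal for $h\in C(Q)$ if either $h(\mathbf{p}_i)=(-1)^i\|h\|$ for all indices $i$ of the path, or $h(\mathbf{p}_i)=(-1)^{i+1}\|h\|$ for all indices $i$ of the path.
   Formalization: The formal theorem additionally assumes that f and G_0 are not identical on Q (so the error is nonzero); without this the claim fails, e.g. for Q a single point and f = G_0, where G_0 is a best approximation but Q contains no closed or infinite path. *)

(* Defs.v *)
From HB Require Import structures.
From mathcomp Require Import all_boot all_order all_algebra.
From mathcomp Require Import all_classical all_reals all_analysis.

Set Implicit Arguments.
Unset Strict Implicit.
Unset Printing Implicit Defensive.

Import Order.TTheory GRing.Theory Num.Theory.
Import numFieldNormedType.Exports.

Local Open Scope classical_set_scope.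
Local Open Scope ring_scope.

Definition dotv (R : realType) (d : nat) (a x : 'rV[R]_d) : R :=
  \sum_(i < d) a 0 i * x 0 i.

(* For h continuous on a nonempty compact Q this supremum is attained. *)
Definition unorm (R : realType) (d : nat) (Q : set 'rV[R]_d)
    (h : 'rV[R]_d -> R) : R :=
  sup [set `|h x| | x in Q].

(* An element of C(Q) is represented by a function on the whole of R^d of which
   only the values on Q matter, hence the equation is required on Q only. *)
Definition ridge_space (R : realType) (d : nat) (Q : set 'rV[R]_d)
    (a1 a2 : 'rV[R]_d) : set ('rV[R]_d -> R) :=
  [set G | exists g1 g2 : R -> R, [/\ continuous g1, continuous g2 &
     forall x, Q x -> G x = g1 (dotv a1 x) + g2 (dotv a2 x)]].

Definition best_approx (R : realType) (d : nat) (Q : set 'rV[R]_d)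
    (a1 a2 : 'rV[R]_d) (f G0 : 'rV[R]_d -> R) : Prop :=
  ridge_space Q a1 a2 G0 /\
  unorm Q (f \- G0) = inf [set unorm Q (f \- G) | G in ridge_space Q a1 a2].

(* Sequences are indexed from 0: [p i] is the point p_(i+1). The index set [I]
   is [`I_n] for a path with n points and [setT] for an infinite path. *)
Definition alternating (R : realType) (d : nat) (a b : 'rV[R]_d)
    (I : set nat) (p : nat -> 'rV[R]_d) : Prop :=
  forall i, I i.+1 ->
    if odd i then dotv b (p i) = dotv b (p i.+1)
    else dotv a (p i) = dotv a (p i.+1).

Definition is_path (R : realType) (d : nat) (Q : set 'rV[R]_d)
    (a1 a2 : 'rV[R]_d) (I : set nat) (p : nat -> 'rV[R]_d) : Prop :=
  [/\ forall i, I i -> Q (p i),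
      forall i, I i.+1 -> p i <> p i.+1 &
      alternating a1 a2 I p \/ alternating a2 a1 I p].

Definition infinite_path (R : realType) (d : nat) (Q : set 'rV[R]_d)
    (a1 a2 : 'rV[R]_d) (p : nat -> 'rV[R]_d) : Prop :=
  is_path Q a1 a2 setT p.

(* The closed path consists of [p 0, ..., p n.-1]; [p n] is its return to the
   starting point. *)
Definition closed_path (R : realType) (d : nat) (Q : set 'rV[R]_d)
    (a1 a2 : 'rV[R]_d) (n : nat) (p : nat -> 'rV[R]_d) : Prop :=
  [/\ (0 < n)%N, ~~ odd n, is_path Q a1 a2 `I_n.+1 p & p n = p 0%N].

Definition extremal (R : realType) (d : nat) (Q : set 'rV[R]_d)
    (h : 'rV[R]_d -> R) (I : set nat) (p : nat -> 'rV[R]_d) : Prop :=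
  (forall i, I i -> h (p i) = (-1) ^+ i.+1 * unorm Q h) \/
  (forall i, I i -> h (p i) = (-1) ^+ i.+2 * unorm Q h).

(* Main.v *)
Require Import Defs.
From HB Require Import structures.
From mathcomp Require Import all_boot all_order all_algebra.
From mathcomp Require Import all_classical all_reals all_analysis.
From mathcomp Require Import ring lra.

Set Implicit Arguments.
Unset Strict Implicit.
Unset Printing Implicit Defensive.

Import Order.TTheory GRing.Theory Num.Theory.
Import numFieldNormedType.Exports.

Local Open Scope classical_set_scope.
Local Open Scope ring_scope.

(* A closed path repeats periodically as an infinite path, so only infinite
   paths matter. Along an infinite path extremal for h = f - G0, the alternating
   sums of a ridge function telescope and stay bounded, while those of h grow
   like n ||h||; hence no ridge correction lowers the norm.

   Conversely, regard every point x with h x = ||h|| as an edge from the value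
   a2.x to the value a1.x, and every point with h x = -||h|| as an edge from
   a1.x to a2.x. Extremal paths are the walks of this graph on two copies of
   the line. If there is no infinite walk then, by Tychonoff's theorem, there is
   e > 0 such that even the walks allowed to jump by e between consecutive edges
   have bounded length. A Lipschitz regularisation of the longest-walk function
   is then a continuous potential that strictly increases along every edge; its
   two branches give a ridge function with the sign of h wherever |h| = ||h||,
   and moving towards it improves the approximation. *)

(** * Chains of edges and their potential *)

(* A point [z] of [K b] is an edge from the value [c (~~ b) z] to the value
   [c b z]; [chain_end K c e n b r] says that some chain of [n] edges, with
   jumps of size at most [e] between them, ends at the value [r] of [c b]. *)
Fixpoint chain_end (R : realType) (T : Type) (K : bool -> set T)
    (c : bool -> T -> R) (e : R) (n : nat) (b : bool) (r : R) : Prop :=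
  if n is m.+1 then
    exists z r', [/\ K b z, c b z = r, `|c (~~ b) z - r'| <= e &
      chain_end K c e m (~~ b) r']
  else True.

Lemma chain_endS (R : realType) (T : Type) (K : bool -> set T)
    (c : bool -> T -> R) (e : R) (n : nat) (b : bool) (r : R) :
  chain_end K c e n.+1 b r -> chain_end K c e n b r.
Proof.
elim: n b r => [//|n IHn] b r [z [r' [Kz cz zr' /IHn r'n]]].
by exists z, r'.
Qed.

Lemma chain_end_le (R : realType) (T : Type) (K : bool -> set T)
    (c : bool -> T -> R) (e : R) (m n : nat) (b : bool) (r : R) :
  (m <= n)%N -> chain_end K c e n b r -> chain_end K c e m b r.
Proof.
move=> /subnK <-; elim: (n - m)%N => [//|k IHk].
by rewrite addSn => /chain_endS.
Qed.

Lemma lipschitz_continuous (R : realType) (f : R -> R) (L : R) :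
  (forall x y, f x <= f y + L * `|x - y|) -> continuous f.
Proof.
move=> fL x; apply/cvgrPdist_le => e e0.
have L0 : 0 <= L.
  by have := fL 0 1; have := fL 1 0; rewrite subr0 sub0r normrN normr1; lra.
near=> y.
have yx : L * `|x - y| <= e.
  (* [L + 1] is positive even when [L] is 0, so [e] can be divided by it. *)
  apply: (@le_trans _ _ ((L + 1) * `|x - y|)).
    by rewrite ler_wpM2r// lerDl.
  rewrite mulrC -ler_pdivlMr ?ltr_wpDl//.
  near: y; apply: cvgr_dist_le; first exact: cvg_id.
  by rewrite divr_gt0// ltr_wpDl.
rewrite ler_norml; apply/andP; split.
  by have := fL y x; rewrite distrC; lra.
by have := fL x y; lra.
Unshelve. all: by end_near. Qed.

(* [phi b r] is the supremum of [n - L |r - r'|] over the lengths [n] of the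
   [e]-chains ending at [r']; [L] is so large that a jump longer than [e] costs
   more than any chain can gain. *)
Lemma potential_exists (R : realType) (T : Type) (K : bool -> set T)
    (c : bool -> T -> R) (e : R) (N : nat) :
  0 < e -> (forall b r, ~ chain_end K c e N b r) ->
  exists phi : bool -> R -> R, (forall b, continuous (phi b)) /\
    forall b z, K b z -> phi (~~ b) (c (~~ b) z) + 1 <= phi b (c b z).
Proof.
move=> e0 noN.
have lenN n b r : chain_end K c e n b r -> n%:R <= N%:R :> R.
  move=> nbr; rewrite ler_nat leqNgt; apply/negP => Nn.
  exact: (noN b r (chain_end_le (ltnW Nn) nbr)).
pose L : R := N%:R / e.
have L0 : 0 <= L by rewrite divr_ge0// ltW.
pose W b r := [set w : R | exists n r',
  chain_end K c e n b r' /\ w = n%:R - L * `|r - r'|].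
have WN b r : ubound (W b r) N%:R.
  move=> _ [n [r' [/lenN nN ->]]]; rewrite lerBlDr (le_trans nN)// lerDl.
  by rewrite mulr_ge0.
have W0 b r : W b r !=set0 by exists (0%:R - L * `|r - r|), 0%N, r.
have leW b r n r' : chain_end K c e n b r' ->
    n%:R - L * `|r - r'| <= sup (W b r).
  by move=> nr'; apply: ub_le_sup; [exists N%:R; exact: WN | exists n, r'].
exists (fun b r => sup (W b r)); split=> [b|b z Kz].
  apply: (@lipschitz_continuous _ _ L) => x y.
  apply: ge_sup => // _ [n [r' [nr' ->]]].
  apply: (@le_trans _ _ (n%:R - L * `|y - r'| + L * `|x - y|)); last first.
    by rewrite lerD2r; exact: leW.
  have : L * `|y - r'| <= L * (`|x - y| + `|x - r'|).
    by rewrite ler_wpM2l// (distrC x y) ler_distD.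
  by rewrite mulrDr; lra.
rewrite -lerBrDr; apply: ge_sup => // _ [n [r' [nr' ->]]]; rewrite lerBrDr.
(* After a short jump [z] prolongs the chain by one edge; a long jump costs at least [N], so the
   single edge [z] does as well. *)
have [zr'|zr'] := leP `|c (~~ b) z - r'| e.
  have := leW b (c b z) n.+1 (c b z); rewrite subrr normr0 mulr0 subr0 -natr1.
  move=> /(_ (ex_intro _ z (ex_intro _ r' (And4 Kz erefl zr' nr')))).
  by apply: le_trans; rewrite lerD2r lerBlDr lerDl mulr_ge0.
have : 1%:R <= sup (W b (c b z)).
  have := leW b (c b z) 1%N (c b z); rewrite subrr normr0 mulr0 subr0; apply.
  by exists z, (c (~~ b) z); split; rewrite // subrr normr0 ltW.
have : N%:R <= L * `|c (~~ b) z - r'|.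
  by rewrite /L mulrAC ler_pdivlMr// ler_wpM2l// ltW.
by have := lenN _ _ _ nr'; lra.
Qed.

(** * Infinite chains by compactness *)

(** The chain is read backwards from its last edge. Tychonoff's theorem needs total sequences, so
    arbitrary points of the [K b] fill the places beyond the chain. *)
Lemma chain_sequence (R : realType) (T : Type) (K : bool -> set T)
    (c : bool -> T -> R) (e : R) (n : nat) (b : bool) (r : R) :
  (forall b, K b !=set0) -> chain_end K c e n b r ->
  exists p : nat -> T, [/\ forall i, K (b (+) odd i) (p i),
    (0 < n)%N -> c b (p 0%N) = r &
    forall i, (i.+1 < n)%N ->
      `|c (~~ (b (+) odd i)) (p i) - c (~~ (b (+) odd i)) (p i.+1)| <= e].
Proof.
move=> K0; elim: n b r => [b r _|n IHn b r [z [r' [Kz cz zr' /IHn]]]].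
  exists (fun i => sval (cid (K0 (b (+) odd i)))); split => // i.
  exact: svalP (cid (K0 (b (+) odd i))).
move=> [p [Kp cp pe]]; exists (fun i => if i is j.+1 then p j else z).
split=> [[|i]||[|i]] //=; first by rewrite addbF.
- by rewrite addbN -addNb.
- by rewrite ltnS addbF => n0; rewrite cp.
- by rewrite ltnS addbN -addNb => /pe.
Qed.

(** Along a finer filter converging to [x], [g] tends both to [g x] and to [l]. *)
Lemma cluster_continuous_eq (R : realType) (T : topologicalType)
    (u : nat -> T) (x : T) (g : T -> R) (l : R) :
  cluster (u @ \oo) x -> {for x, continuous g} -> g \o u @ \oo --> l ->
  g x = l.
Proof.
rewrite cluster_cvgE => -[G PG [Gx uG]] gx gul.
have gl : g @ G --> l by move=> A Al; apply: uG; exact: gul A Al.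
by apply: (cvg_unique (@Rhausdorff R) _ gl); exact: cvg_comp Gx gx.
Qed.

(** The first [n] jumps of the sequence [u n] are at most [1/(n+1)]. Each jump is continuous on the
    product space, so it vanishes at a cluster point. *)
Lemma infinite_chain (R : realType) (T : topologicalType)
    (K : bool -> set T) (c : bool -> T -> R) :
  (forall b, compact (K b)) -> (forall b, continuous (c b)) ->
  (forall e N, 0 < e -> exists b r, chain_end K c e N b r) ->
  exists p : nat -> T, forall i,
    K (~~ odd i) (p i) /\ c (odd i) (p i) = c (odd i) (p i.+1).
Proof.
move=> Kc cc chains.
(* A chain of two edges meets both [K true] and [K false]. *)
have K0 b : K b !=set0.
  have [[] [r [z [r' [Kz _ _ [z' [r'' [Kz' _ _ _]]]]]]]] := chains 1 2 ltr01.
    by case: b; [exists z | exists z'].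
  by case: b; [exists z' | exists z].
have uP n : exists p : nat -> T, (forall i, K (~~ odd i) (p i)) /\
    forall i, (i < n)%N ->
      `|c (odd i) (p i) - c (odd i) (p i.+1)| <= n.+1%:R^-1.
  have [r rn] : exists r, chain_end K c n.+1%:R^-1 n.+1 true r.
    have n0 : 0 < n.+1%:R^-1 :> R by rewrite invr_gt0.
    (* The spare edge of [n.+2] fixes the side: a chain ending on the [false] side loses its last
       edge. *)
    have [[] [r]] := chains n.+1%:R^-1 n.+2 n0.
      by move=> /chain_endS; exists r.
    by move=> [z [r' [_ _ _ r'n]]]; exists r'.
  have [p [Kp _ pe]] := chain_sequence K0 rn; exists p; split.
    by move=> i; rewrite -addTb; exact: Kp.
  by move=> i ilt; have := pe i ilt; rewrite addTb negbK.
pose u n : forall _ : nat, T := sval (cid (uP n)).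
have Ku n i : K (~~ odd i) (u n i) by have [] := svalP (cid (uP n)).
have ue n i : (i < n)%N ->
    `|c (odd i) (u n i) - c (odd i) (u n i.+1)| <= n.+1%:R^-1.
  by move: i; have [] := svalP (cid (uP n)).
have [|p [Kp up]] := tychonoff (fun i => Kc (~~ odd i)) (F := u @ \oo) _.
  by exists 0%N => // n _ i; exact: Ku.
 exists p => i; split; first exact: Kp.
pose X := prod_topology (fun _ : nat => T).
have pc j : continuous (fun q : X => c (odd i) (q j)).
  move=> q; apply: (@continuous_comp X T R (@proj nat (fun=> T) j)).
    exact: proj_continuous.
  exact: cc.
apply/eqP; rewrite -subr_eq0; apply/eqP.
apply: (@cluster_continuous_eq R X u p
  (fun q => c (odd i) (q i) - c (odd i) (q i.+1)) 0 up).
  exact: cvgB (pc i p) (pc i.+1 p).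
apply/cvgrPdist_le => e e0; near=> n; rewrite /= sub0r normrN.
apply: le_trans (ue n i _) _; first by near: n; exact: nbhs_infty_gt.
by apply: ltW; near: n; exact: (near_infty_natSinv_lt (PosNum e0)).
Unshelve. all: by end_near. Qed.

(** * Compactness, the uniform norm and ridge functions *)

Lemma compact_level_set (R : realType) (T : topologicalType) (Q : set T)
    (h : T -> R) (y : R) :
  compact Q -> {within Q, continuous h} -> compact [set x | Q x /\ h x = y].
Proof.
move=> Qc hc.
have /continuous_closedP/(_ [set y]) := hc.
case/(_ _)/closed_subspaceP; first exact: closed_eq.
move=> V Vcl VQ; rewrite (_ : mkset _ = Q `&` V); first exact: compact_closedI.
by rewrite setIC VQ; apply/seteqP; split => x [].
Qed.

Lemma dotv_continuous (R : realType) (d : nat) (a : 'rV[R]_d) :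
  continuous (dotv a).
Proof.
rewrite /dotv; apply: continuous_big => [|i _ x]; first exact: add_continuous.
by apply: continuousM; [exact: cst_continuous | exact: coord_continuous].
Qed.

Lemma compact_norm_bounded (R : realType) (T : topologicalType) (Q : set T)
    (h : T -> R) :
  compact Q -> {within Q, continuous h} ->
  exists C, forall x, Q x -> `|h x| <= C.
Proof.
move=> Qc hc; have [M [_ QM]] := compact_bounded (continuous_compact hc Qc).
by exists (M + 1) => x Qx; apply: QM; [rewrite ltrDl | exists x].
Qed.

Lemma ridge_within_continuous (R : realType) (d : nat) (Q : set 'rV[R]_d)
    (a1 a2 : 'rV[R]_d) (G : 'rV[R]_d -> R) :
  ridge_space Q a1 a2 G -> {within Q, continuous G}.
Proof.
move=> [g1 [g2 [g1c g2c GE]]].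
pose G' x := g1 (dotv a1 x) + g2 (dotv a2 x).
have G'c : {within Q, continuous G'}.
  have compc (g : R -> R) a : continuous g -> continuous (g \o dotv a).
    move=> gc x; apply: continuous_comp; first exact: dotv_continuous.
    exact: gc.
  apply: continuous_subspaceT => x.
  by apply: (@continuousD _ _ _ (g1 \o dotv a1) (g2 \o dotv a2)); exact: compc.
apply: subspace_eq_continuous G'c => x xQ.
by rewrite /from_subspace /G' GE //; exact: set_mem.
Qed.

Lemma le_unorm (R : realType) (d : nat) (Q : set 'rV[R]_d)
    (h : 'rV[R]_d -> R) (x : 'rV[R]_d) :
  compact Q -> {within Q, continuous h} -> Q x -> `|h x| <= unorm Q h.
Proof.
move=> Qc hc Qx; have [C hC] := compact_norm_bounded Qc hc.
by apply: ub_le_sup; [exists C => _ [z Qz <-]; exact: hC | exists x].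
Qed.

Lemma unorm_le (R : realType) (d : nat) (Q : set 'rV[R]_d)
    (h : 'rV[R]_d -> R) (B : R) :
  Q !=set0 -> (forall x, Q x -> `|h x| <= B) -> unorm Q h <= B.
Proof.
move=> [x Qx] hB; apply: ge_sup; first by exists `|h x|, x.
by move=> _ [z Qz <-]; exact: hB.
Qed.

Lemma unorm_ge0 (R : realType) (d : nat) (Q : set 'rV[R]_d)
    (h : 'rV[R]_d -> R) : 0 <= unorm Q h.
Proof.
have [[[y [x Qx _]] ub]|nosup] := pselect (has_sup [set `|h x| | x in Q]).
  by apply: (@le_trans _ _ `|h x|) => //; apply: ub_le_sup => //; exists x.
(* By convention [sup] is 0 when no supremum exists. *)
by rewrite /unorm sup_out.
Qed.

Lemma ridge_spaceD (R : realType) (d : nat) (Q : set 'rV[R]_d)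
    (a1 a2 : 'rV[R]_d) (F G : 'rV[R]_d -> R) (e : R) :
  ridge_space Q a1 a2 F -> ridge_space Q a1 a2 G ->
  ridge_space Q a1 a2 (fun x => F x + e * G x).
Proof.
move=> [f1 [f2 [f1c f2c FE]]] [g1 [g2 [g1c g2c GE]]].
exists (fun s => f1 s + e * g1 s), (fun s => f2 s + e * g2 s); split.
- by move=> s; apply: cvgD; [exact: f1c | apply: cvgMr; exact: g1c].
- by move=> s; apply: cvgD; [exact: f2c | apply: cvgMr; exact: g2c].
- by move=> x Qx; rewrite FE// GE//; ring.
Qed.

(** * The lower bound from an extremal path *)

(** The [ka] terms cancel between indices [2k] and [2k+1], the [kb] terms between [2k+1] and
    [2k+2]. *)
Lemma alternating_sum (R : realType) (d : nat) (a b : 'rV[R]_d)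
    (ka kb : R -> R) (p : nat -> 'rV[R]_d) (n : nat) :
  Defs.alternating a b setT p ->
  \sum_(i < n.*2) (-1) ^+ i * (ka (dotv a (p i)) + kb (dotv b (p i))) =
  kb (dotv b (p 0%N)) - kb (dotv b (p n.*2)).
Proof.
move=> alt; elim: n => [|n IHn]; first by rewrite big_ord0 subrr.
rewrite doubleS !big_ord_recr /= IHn.
have := alt n.*2 I; have := alt n.*2.+1 I; rewrite /= odd_double/= => <- <-.
by rewrite exprS -signr_odd odd_double; ring.
Qed.

(** As [n] is even, reduction modulo [n] keeps the parity of an index, hence the direction of each
    step and the sign of [h]. *)
Lemma closed_path_infinite (R : realType) (d : nat) (Q : set 'rV[R]_d)
    (a1 a2 : 'rV[R]_d) (h : 'rV[R]_d -> R) (n : nat) (p : nat -> 'rV[R]_d) :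
  closed_path Q a1 a2 n p -> extremal Q h `I_n p ->
  exists q, infinite_path Q a1 a2 q /\ extremal Q h setT q.
Proof.
move=> [n0 nev [pQ pne palt] pn] ext; exists (fun i => p (i %% n)%N).
have oddm i : odd (i %% n) = odd i.
  by rewrite {2}(divn_eq i n) oddD oddM (negbTE nev) andbF.
have in_n i : (i %% n < n)%N by rewrite ltn_mod.
have pS i : p (i.+1 %% n)%N = p (i %% n).+1.
  rewrite -(addn1 i) -modnDml addn1.
  have := in_n i; rewrite leq_eqVlt => /orP[/eqP in1|lt_in].
    by rewrite in1 modnn pn.
  by rewrite (modn_small lt_in).
split; last first.
  have sgn i : (-1) ^+ (i %% n) = (-1) ^+ i :> R.
    by rewrite -signr_odd oddm signr_odd.
  by case: ext => ext; [left | right] => i _;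
    rewrite (ext _ (in_n i)) !exprS sgn.
split=> [i _|i _|]; first by apply: pQ; exact: leqW (in_n i).
  by rewrite pS; apply: pne; exact: in_n.
by case: palt => alt; [left | right] => i _;
  rewrite pS -oddm; exact: alt (in_n i).
Qed.

Lemma extremal_path_unorm_le (R : realType) (d : nat) (Q : set 'rV[R]_d)
    (a1 a2 : 'rV[R]_d) (h D : 'rV[R]_d -> R) (p : nat -> 'rV[R]_d) :
  compact Q -> {within Q, continuous h} -> ridge_space Q a1 a2 D ->
  infinite_path Q a1 a2 p -> extremal Q h setT p ->
  unorm Q h <= unorm Q (h \- D).
Proof.
move=> Qc hc Dr [Qp _ alt] ext; set M := unorm Q h; set U := unorm Q _.
(* The sign [s] merges the two cases of extremality. *)
have [s [s1 hs]] : exists s : R, `|s| = 1 /\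
    forall i, s * ((-1) ^+ i * h (p i)) = M.
  case: ext => ext; [exists (-1) | exists 1];
    (split; rewrite ?normrN1 ?normr1// => i; rewrite ext// -/M -[RHS]mul1r);
    by rewrite -[X in _ = X * _](sqrr_sign R i) !exprS expr0; ring.
have [a [b [ka [kb [altab kbc DE]]]]] : exists a b ka kb,
    [/\ Defs.alternating a b setT p, continuous kb &
      forall x, Q x -> D x = ka (dotv a x) + kb (dotv b x)].
  have [g1 [g2 [g1c g2c DE]]] := Dr.
  case: alt => alt; first by exists a1, a2, g1, g2.
  by exists a2, a1, g2, g1; split=> // x Qx; rewrite DE// addrC.
have [C kbC] : exists C, forall x, Q x -> `|(kb \o dotv b) x| <= C.
  apply: compact_norm_bounded => //; apply: continuous_subspaceT => x.
  by apply: continuous_comp; [exact: dotv_continuous | exact: kbc].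
have hDc : {within Q, continuous (h \- D)}.
  move=> x; apply: cvgB; first exact: hc.
  exact: (ridge_within_continuous Dr).
(* [D] contributes at most [2C] to the alternating sum, whatever [n] is. *)
have nMU n : n.*2%:R * M <= n.*2%:R * U + (C + C).
  have <- : \sum_(i < n.*2) s * ((-1) ^+ i * h (p i)) = n.*2%:R * M.
    under eq_bigr do rewrite hs.
    by rewrite sumr_const card_ord mulr_natl.
  have -> : \sum_(i < n.*2) s * ((-1) ^+ i * h (p i)) =
      \sum_(i < n.*2) s * ((-1) ^+ i * (h \- D) (p i)) +
      s * (kb (dotv b (p 0%N)) - kb (dotv b (p n.*2))).
    rewrite -(alternating_sum ka kb n altab) mulr_sumr -big_split/=.
    by apply: eq_bigr => i _; rewrite DE; [ring | exact: Qp].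
  apply: lerD.
    rewrite -[n.*2 in leRHS]card_ord mulr_natl -sumr_const.
    apply: ler_sum => i _; apply: le_trans (ler_norm _) _.
    rewrite !normrM s1 normr_sign !mul1r; apply: le_unorm => //; exact: Qp.
  apply: le_trans (ler_norm _) _; rewrite normrM s1 mul1r.
  by apply: le_trans (ler_normB _ _) _; apply: lerD; apply: kbC; exact: Qp.
rewrite leNgt; apply/negP => UM.
have MU : 0 < M - U by rewrite subr_gt0.
pose n := Num.bound `|C / (M - U)|.
have : C < n%:R * (M - U).
  rewrite -ltr_pdivrMr//; apply: le_lt_trans (ler_norm _) _.
  exact: archi_boundP.
by have := nMU n; rewrite -mul2n natrM; lra.
Qed.

(** * Improvement in the absence of an infinite extremal path *)

(* The perturbative half of Kolmogorov's criterion for best approximation. *)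
Lemma unorm_decrease (R : realType) (d : nat) (Q : set 'rV[R]_d)
    (h G : 'rV[R]_d -> R) :
  compact Q -> Q !=set0 -> {within Q, continuous h} ->
  {within Q, continuous G} ->
  (forall x, Q x -> `|h x| = unorm Q h -> 0 < h x * G x) ->
  exists e : R, unorm Q (fun x => h x - e * G x) < unorm Q h.
Proof.
move=> Qc Q0 hc Gc hG; set M := unorm Q h.
have hM x : Q x -> `|h x| <= M by exact: le_unorm.
(* The second bracket is twice the positive part of [h x * G x]; it is positive wherever the first
   one vanishes, so [w] has a positive minimum. *)
pose w x := (M - `|h x|) + (`|h x * G x| + h x * G x).
have wc : {within Q, continuous w}.
  move=> x; apply: cvgD.
    by apply: cvgB; [exact: cvg_cst | apply: cvg_norm; exact: hc].
  by apply: cvgD; [apply: cvg_norm|]; apply: cvgM; (exact: hc || exact: Gc).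
have [c /set_mem Qcc wmin] := compact_EVT_min Q0 Qc wc.
have w0 : 0 < w c.
  have := hM c Qcc; rewrite le_eqVlt => /orP[/eqP hcM|hcM].
    by have := hG c Qcc hcM; rewrite /w hcM => ?; rewrite subrr add0r ltr_wpDl.
  rewrite /w ltr_pwDl ?subr_gt0//; have := ler_norm (- (h c * G c)).
  by rewrite normrN; lra.
have [B GB] := compact_norm_bounded Qc Gc.
pose C := `|B| + 1.
have C0 : 0 < C by rewrite ltr_wpDl.
have GC x : Q x -> `|G x| <= C.
  by move=> /GB /le_trans; apply; rewrite /C (le_trans (ler_norm B))// lerDl.
pose e := w c / (4 * (C + C ^+ 2)).
have CC0 : 0 < C + C ^+ 2 by rewrite addr_gt0// exprn_gt0.
have e0 : 0 < e by rewrite divr_gt0// mulr_gt0.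
have eCC : e * C + e * C ^+ 2 = w c / 4.
  by rewrite -mulrDr /e; field; rewrite gt_eqF.
have eC2 : 0 < e * C ^+ 2 by rewrite mulr_gt0// exprn_gt0.
have eC : 0 < e * C by rewrite mulr_gt0.
pose h' x := h x - e * G x.
have h'M x : Q x -> `|h' x| < M.
  move=> Qx; have wx : w c <= w x by apply: wmin; exact: mem_set.
  (* Either [|h x|] is too far below [M] for a change of [e * C] to matter, or [h x * G x] exceeds
     [w c / 4] and expanding [h' x ^+ 2] shows a decrease. *)
  have [hx|hx] := leP (w c / 2) (M - `|h x|).
    apply: (@le_lt_trans _ _ (`|h x| + e * C)); last by lra.
    apply: le_trans (ler_normB _ _) _; rewrite lerD2l normrM gtr0_norm//.
    by rewrite ler_wpM2l ?GC// ltW.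
  have hGx : w c / 4 < h x * G x.
    have : w c / 2 < `|h x * G x| + h x * G x by move: wx; rewrite {2}/w; lra.
    by case: (ger0P (h x * G x)) => ?; lra.
  rewrite ltNge; apply/negP => Mh'.
  have sq (y z : R) : `|y| <= `|z| -> y ^+ 2 <= z ^+ 2.
    move=> yz; rewrite -(real_normK (num_real y)) -(real_normK (num_real z)).
    by rewrite ler_pXn2r// nnegrE.
  have M0 : `|M| = M by rewrite ger0_norm// unorm_ge0.
  have h1 : h x ^+ 2 <= M ^+ 2 by apply: sq; rewrite M0 hM.
  have h2 : M ^+ 2 <= h' x ^+ 2 by apply: sq; rewrite M0.
  have h3 : G x ^+ 2 <= C ^+ 2 by apply: sq; rewrite (gtr0_norm C0) GC.
  have h4 : h' x ^+ 2 = h x ^+ 2 - 2 * (e * (h x * G x)) + e * (e * G x ^+ 2).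
    by rewrite /h'; ring.
  have h5 : e * (w c / 4) < e * (h x * G x) by rewrite ltr_pM2l.
  have h6 : e * (e * G x ^+ 2) <= e * (w c / 4).
    rewrite ler_pM2l//; apply: (@le_trans _ _ (e * C ^+ 2)); last by lra.
    by rewrite ler_pM2l.
  have h7 : 0 < e * (w c / 4) by rewrite mulr_gt0// divr_gt0.
  lra.
exists e; rewrite -/h'.
(* The maximum of [|h'|] is attained, so the strict bound passes to the norm. *)
have h'c : {within Q, continuous (fun x => `|h' x|)}.
  move=> x; apply: cvg_norm; apply: cvgB; first exact: hc.
  by apply: cvgMr; exact: Gc.
have [m /set_mem Qm mmax] := compact_EVT_max Q0 Qc h'c.
apply: le_lt_trans (h'M m Qm); apply: unorm_le => // x Qx.
by apply: mmax; exact: mem_set.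
Qed.

Lemma separating_ridge (R : realType) (d : nat) (Q : set 'rV[R]_d)
    (a1 a2 : 'rV[R]_d) (h : 'rV[R]_d -> R) :
  compact Q -> {within Q, continuous h} -> 0 < unorm Q h ->
  ~ (exists p, infinite_path Q a1 a2 p /\ extremal Q h setT p) ->
  exists2 G, ridge_space Q a1 a2 G &
    forall x, Q x -> `|h x| = unorm Q h -> 0 < h x * G x.
Proof.
move=> Qc hc; set M := unorm Q h => M0 nopath.
pose K b := [set x | Q x /\ h x = if b then M else - M].
pose c b := dotv (if b then a1 else a2).
have Kc b : compact (K b) by exact: compact_level_set.
have cc b : continuous (c b) by exact: dotv_continuous.
have [[e [N [e0 noN]]]|chains] := pselect (exists e N, 0 < e /\
    forall b r, ~ chain_end K c e N b r); last first.
  exfalso; apply: nopath.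
  have [e N e0|p Kp] := infinite_chain Kc cc.
    apply: contrapT => no; apply: chains; exists e, N; split=> // b r br.
    by apply: no; exists b, r.
  have hp i : h (p i) = (-1) ^+ i * M.
    have [[_ ->] _] := Kp i; rewrite -signr_odd.
    by case: (odd i); rewrite /= ?expr1 ?expr0 ?mulN1r ?mul1r.
  exists p; split; last first.
    by right => i _; rewrite hp !exprS mulrA mulN1r opprK mul1r.
  split=> [i _|i _ pp|]; first by have [[]] := Kp i.
    (* [h] takes opposite nonzero values at consecutive points. *)
    have /eqP : (-1) ^+ i * M = 0.
      by have := hp i.+1; rewrite -pp hp exprS mulN1r mulNr; lra.
    by rewrite mulf_eq0 signr_eq0 gt_eqF.
  by right => i _; have [_] := Kp i; rewrite /c; case: (odd i).
have [phi [phic phiK]] := potential_exists e0 noN.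
(* The potential rises by 1 along each edge: this function is at least 1 where [h = M] and at most
   -1 where [h = - M]. *)
exists (fun x => phi true (dotv a1 x) - phi false (dotv a2 x)).
  exists (phi true), (- phi false); split => //.
  by move=> s; apply: cvgN; exact: phic.
move=> x Qx hx; have [hx0|hx0] := leP 0 (h x).
  have hE : h x = M by rewrite -hx ger0_norm.
  have := phiK true x (conj Qx hE); rewrite /= hE => ?.
  by rewrite mulr_gt0//; lra.
have hE : h x = - M by rewrite -hx ltr0_norm// opprK.
have := phiK false x (conj Qx hE); rewrite /= hE => ?.
by rewrite nmulr_rgt0 ?oppr_lt0//; lra.
Qed.

Theorem theorem2p1 (R : realType) (d : nat) (Q : set 'rV[R]_d)
    (a1 a2 : 'rV[R]_d) (f G0 : 'rV[R]_d -> R)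
    (Qcompact : compact Q) (a1_neq0 : a1 <> 0) (a2_neq0 : a2 <> 0)
    (fcont : {within Q, continuous f})
    (G0ridge : ridge_space Q a1 a2 G0)
    (f_neq_G0 : exists2 x, Q x & f x <> G0 x) :
  best_approx Q a1 a2 f G0 <->
  exists p : nat -> 'rV[R]_d,
    (exists2 n, closed_path Q a1 a2 n p & extremal Q (f \- G0) `I_n p) \/
    (infinite_path Q a1 a2 p /\ extremal Q (f \- G0) setT p).
Proof.
have hc : {within Q, continuous (f \- G0)}.
  move=> x; apply: cvgB; first exact: fcont.
  exact: (ridge_within_continuous G0ridge).
have [x0 Qx0 fx0] := f_neq_G0.
have M0 : 0 < unorm Q (f \- G0).
  apply: (@lt_le_trans _ _ `|(f \- G0) x0|); last exact: le_unorm.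
  by rewrite normr_gt0 subr_eq0; apply/eqP.
have inf_le G : ridge_space Q a1 a2 G ->
    inf [set unorm Q (f \- G) | G in ridge_space Q a1 a2] <= unorm Q (f \- G).
  move=> Gr; apply: ge_inf; last by exists G.
  by exists 0 => _ [F _ <-]; exact: unorm_ge0.
split=> [[_ best]|pathP].
  apply: contrapT => nopath.
  have [|G Gr hG] := separating_ridge Qcompact hc M0 (a1 := a1) (a2 := a2).
    by move=> [p pP]; apply: nopath; exists p; right.
  have Q0 : Q !=set0 by exists x0.
  have [e] := unorm_decrease Qcompact Q0 hc (ridge_within_continuous Gr) hG.
  rewrite best ltNge => /negP; apply.
  have -> : (fun x => (f \- G0) x - e * G x) = f \- (fun x => G0 x + e * G x).
    by apply/funext => x /=; ring.
  exact/inf_le/ridge_spaceD.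
have [p [pinf pext]] : exists p, infinite_path Q a1 a2 p /\
    extremal Q (f \- G0) setT p.
  by have [p [[n /closed_path_infinite]|]] := pathP; [apply | exists p].
split=> //; apply/eqP; rewrite eq_le inf_le// andbT.
apply: lb_le_inf; first by exists (unorm Q (f \- G0)), G0.
move=> _ [G Gr <-].
(* Subtracting [G - G0] from [f - G0] leaves [f - G]. *)
have Dr := ridge_spaceD (-1) Gr G0ridge.
have := extremal_path_unorm_le Qcompact hc Dr pinf pext; congr (_ <= unorm Q _).
by apply/funext => x /=; ring.
Qed.
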